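(* There is a constant $c>0$ such that $M'(\epsilon)\ge \operatorname{twr}(c/\epsilon^{1/2})$ for every $0<\epsilon<c$, where $M'(\epsilon)$ denotes the smallest integer such that every finite graph has an $\epsilon$-nice equipartition of order at most $M'(\epsilon)$.
   Context: For nonempty vertex sets $A,B$ of a finite graph $G$, let $d_G(A,B)=e(A,B)/(|A||B|)$, where $e(A,B)$ is the number of edges with one vertex in $A$ and the other in $B$ (formally, the number of pairs $(x,y)\in A\times B$ with $xy$ an edge). The pair $(A,B)$ is $\epsilon$-regular if $|d_G(A,B)-d_G(A',B')|\le\epsilon$ for all $A'\subseteq A$, $B'\subseteq B$ with $|A'|\ge\epsilon|A|$ and $|B'|\ge\epsilon|B|$. An equipartition of $G$ is a partition $\mathcal{Z}=\{Z_1,\ldots,Z_k\}$ of its vertex set into nonempty parts whose sizes differ by at most $1$; its order is $|\mathcal{Z}|=k$. The equipartition is $\epsilon$-nice if for every $Z\in\mathcal{Z}$, all but at most $\epsilon k$ of the sets $Z'\in\mathcal{Z}$ are such that $(Z,Z')$ is $\epsilon$-regular ($Z'=Z$ is allowed). $M'(\epsilon)$ is finite for every $\epsilon>0$ (a consequence of Szemerédi's regularity lemma). $\operatorname{twr}(x)$ denotes a tower of exponents of height $x$: $\operatorname{twr}(0)=1$, $\operatorname{twr}(h)=2^{\operatorname{twr}(h-1)}$ for integers $h\ge1$, and $\operatorname{twr}(x)=\operatorname{twr}(\lfloor x\rfloor)$ for real $x\ge0$. *)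

(* Defs.v *)
From mathcomp Require Import all_boot all_order all_algebra.
From mathcomp Require Import all_classical all_reals ereal.

Set Implicit Arguments.
Unset Strict Implicit.
Unset Printing Implicit Defensive.
Import Order.TTheory GRing.Theory Num.Theory.

Local Open Scope ring_scope.

Record sgraph := SGraph {
  vertex : finType;
  adj : rel vertex;
  adj_sym : symmetric adj;
  adj_irrefl : irreflexive adj }.

(* Ordered pairs: an edge inside the intersection of A and B counts twice. *)
Definition edges_between (G : sgraph) (A B : {set vertex G}) : nat :=
  #|[set xy in finset.setX A B | adj xy.1 xy.2]|.

Definition density (R : realType) (G : sgraph) (A B : {set vertex G}) : R :=
  (edges_between A B)%:R / (#|A|%:R * #|B|%:R).

Definition regular_pair (R : realType) (eps : R) (G : sgraph)
    (A B : {set vertex G}) : bool :=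
  [forall A' : {set vertex G}, forall B' : {set vertex G},
    [&& A' \subset A, B' \subset B,
        eps * #|A|%:R <= #|A'|%:R & eps * #|B|%:R <= #|B'|%:R] ==>
    (`|density R A B - density R A' B'| <= eps)].

Definition equipartition (G : sgraph) (Z : {set {set vertex G}}) : Prop :=
  finset.partition Z [set: vertex G]%SET /\
  (forall A B, A \in Z -> B \in Z -> (#|A| <= #|B| + 1)%N).

Definition nice (R : realType) (eps : R) (G : sgraph)
    (Z : {set {set vertex G}}) : Prop :=
  forall A, A \in Z ->
    #|[set B in Z | ~~ regular_pair eps A B]|%:R <= eps * #|Z|%:R.

Definition nice_order_bound (R : realType) (eps : R) (n : nat) : Prop :=
  forall G : sgraph, exists Z : {set {set vertex G}},
    [/\ equipartition Z, nice eps Z & (#|Z| <= n)%N].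

(* The least n with [nice_order_bound eps n] (see [Mprime_finE]); it would be
   +oo if there were no such n. *)
Definition Mprime (R : realType) (eps : R) : \bar R :=
  ereal_inf [set n%:R%:E | n in [set n | nice_order_bound eps n]]%classic.

Fixpoint twrn (h : nat) : nat := if h is h'.+1 then (2 ^ twrn h')%N else 1%N.

(* [Num.truncn x] is the floor of x when 0 <= x. *)
Definition twr (R : realType) (x : R) : nat := twrn (Num.truncn x).

Lemma Mprime_finE (R : realType) (eps : R) (n : nat) :
  Mprime eps = n%:R%:E <->
  nice_order_bound eps n /\ (forall m, nice_order_bound eps m -> (n <= m)%N).
Proof.
have least k : nice_order_bound eps k ->
    (forall m, nice_order_bound eps m -> (k <= m)%N) -> Mprime eps = k%:R%:E.
  move=> hk kmin; apply/eqP; rewrite eq_le; apply/andP; split.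
    by apply: ge_ereal_inf => /=; exists k%:R%:E => //; exists k.
  by apply: le_ereal_inf_tmp => _ [m hm <-]; rewrite lee_fin ler_nat kmin.
split=> [Mn|[]]; last exact: least.
have [[k hk]|no] := pselect (exists k, nice_order_bound eps k).
  have ex : exists k, `[< nice_order_bound eps k >] by exists k; exact/asboolP.
  have [m /asboolP hm mmin] := ex_minnP ex.
  have mmin' j : nice_order_bound eps j -> (m <= j)%N.
    by move=> hj; apply: mmin; exact/asboolP.
  suff -> : n = m by [].
  apply/eqP; rewrite -(eqr_nat R); apply/eqP/EFin_inj.
  by rewrite -Mn; exact: least.
move: Mn; rewrite /Mprime (_ : [set _ | _ in _]%classic = set0) ?ereal_inf0 //.
by apply/seteqP; split=> x /= [] m hm; case: no; exists m.
Qed.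

(* Main.v *)
(** A vertex carries nested labels: its class at level [r + 1] is its class at
    level [r] together with a word, indexed by the classes of level [r], from a
    code of exponential size and linear minimum distance.  So the number of
    classes is a tower in the number [s] of levels.  The weight of [xy] is the
    average over the levels [r] of the exclusive or of the bit of [x] at the
    class of [y] and the bit of [y] at the class of [x]; a quasirandom colouring
    of the pairs by the levels turns the weights into a graph.

    In an [eps]-nice equipartition each part lies, up to a proportion
    [32 r eps], in one class of level [r], by induction on [r].  If a part [A]
    has this property for [r] but not for [r + 1], then the code makes a
    constant proportion of the bits of level [r] split [A] into two pieces of
    proportion at least [eps].  For [y] in a class whose bit splits [A], compare
    the mean weights from [y] to the two pieces: level [r] contributes [1 / s]
    with a sign that is a bit of [y], the lower levels contribute nothing, and
    the higher levels cancel on averaging over [y].  Regularity of [A] with most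
    parts bounds the signed sum of these differences by [O(r eps)] per vertex.
    Hence [1 / s = O(s eps)], so the induction runs through all levels when
    [s] is a small multiple of [eps^(-1/2)].  At the last level the parts
    are as small as the classes, and there must be as many of them. *)
Require Import Defs.
From mathcomp Require Import all_boot all_order all_algebra.
From mathcomp Require Import all_classical all_reals ereal.
From mathcomp Require Import zify ring lra.
Set Implicit Arguments.
Unset Strict Implicit.
Unset Printing Implicit Defensive.
Import Order.TTheory GRing.Theory Num.Theory.
Local Open Scope ring_scope.

(** * Binary codes of linear minimum distance and exponential size *)

Definition hamming {T : finType} (c c' : T -> bool) : nat :=
  #|[set t | c t != c' t]|.

(** The sum factors over the coordinates: the two values of a bit contribute 2 and 1. This is the
    exponential moment that bounds the size of Hamming balls. *)
Lemma sum_agreement (T : finType) (c : {ffun T -> bool}) :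
  (\sum_(v : {ffun T -> bool}) 2 ^ (#|T| - hamming v c) = 3 ^ #|T|)%N.
Proof.
transitivity (\sum_(v : {ffun T -> bool})
                \prod_(t : T) (if v t == c t then 2 else 1))%N.
  apply: eq_bigr => v _; rewrite -big_mkcond prod_nat_const; congr (_ ^ _)%N.
  have -> : (#|T| - hamming v c)%N = #|~: [set t | v t != c t]|.
    by rewrite cardsCs finset.setCK.
  by apply: eq_card => t; rewrite !inE negbK.
rewrite -(bigA_distr_bigA (fun t b => if b == c t then 2 else 1)%N).
have -> : (3 ^ #|T| = \prod_(t : T) 3)%N by rewrite prod_nat_const.
apply: eq_bigr => t _.
by rewrite big_bool; case: (c t).
Qed.

(** From [3 ^ 5 <= 2 ^ 8], sixteen factors 3 cost at most [2 ^ 26], which saves 6 over [2 ^ 32]; the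
    remaining factors are bounded by 4 each. *)
Lemma expn3_le k : (3 ^ k <= 2 ^ (2 * k - 6 * (k %/ 16)))%N.
Proof.
have pow x y p q a m n : m = (p * a)%N -> n = (q * a)%N ->
    (x ^ p <= y ^ q -> x ^ m <= y ^ n)%N.
  by move=> -> ->; rewrite !expnM; case: a => // a xy; rewrite leq_exp2r.
have mul x y p q p' q' m n : m = (p + p')%N -> n = (q + q')%N ->
    (x ^ p <= y ^ q -> x ^ p' <= y ^ q' -> x ^ m <= y ^ n)%N.
  by move=> -> ->; rewrite !expnD; apply: leq_mul.
have h1 : (3 ^ 1 <= 2 ^ 2)%N by [].
have h5 : (3 ^ 5 <= 2 ^ 8)%N by [].
have h15 := pow 3%N 2%N 5%N 8%N 3%N 15%N 24%N erefl erefl h5.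
have h16 := mul 3%N 2%N 15%N 24%N 1%N 2%N 16%N 26%N erefl erefl h15 h1.
have hq := pow 3%N 2%N 16%N 26%N (k %/ 16)%N _ _ erefl erefl h16.
have hr := pow 3%N 2%N 1%N 2%N (k %% 16)%N _ _ erefl erefl h1.
apply: (mul _ _ _ _ _ _ _ _ _ _ hq hr); lia.
Qed.

(* Gilbert-Varshamov: a code that is maximal among those that satisfy the first two conditions. *)
Lemma code_exists (T : finType) : (0 < #|T|)%N ->
  exists C : {set {ffun T -> bool}},
  [/\ forall c, c \in C -> [ffun t => ~~ c t] \in C,
      forall c c', c \in C -> c' \in C -> c != c' ->
        (#|T| <= 16 * hamming c c')%N,
      (2 <= #|C|)%N & (2 ^ (#|T| %/ 16) <= #|C|)%N].
Proof.
move=> T0; set k := #|T|.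
pose neg (c : {ffun T -> bool}) : {ffun T -> bool} := [ffun t => ~~ c t].
have negK : involutive neg by move=> c; apply/ffunP => t; rewrite !ffunE negbK.
pose P (C : {set {ffun T -> bool}}) :=
  [forall c in C, neg c \in C] &&
  [forall c in C, forall c' in C, (c != c') ==> (k <= 16 * hamming c c')%N].
have P0 : P finset.set0.
  by apply/andP; split; apply/forall_inP => c; rewrite inE.
have hamC (c c' : {ffun T -> bool}) : hamming c c' = hamming c' c.
  by rewrite /hamming; apply: eq_card => t; rewrite !inE eq_sym.
have hamN (c c' : {ffun T -> bool}) : (hamming (neg c) c' = k - hamming c c')%N.
  have -> : (k - hamming c c')%N = #|~: [set t | c t != c' t]|.
    by rewrite cardsCs finset.setCK.
  by apply: eq_card => t; rewrite !inE ffunE; case: (c t); case: (c' t).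
have hamle (c c' : {ffun T -> bool}) : (hamming c c' <= k)%N by exact: max_card.
have ham0 (c : {ffun T -> bool}) : hamming c c = 0%N.
  by rewrite /hamming; apply: eq_card0 => t; rewrite !inE eqxx.
case: (arg_maxnP (fun C : {set {ffun T -> bool}} => #|C|) P0) => C.
move=> /andP[/forall_inP Cneg /forall_inP Csep] Cmax.
(* A word far from all of [C] is also far from the complements of its members, so it could be added
   together with its own complement, against maximality. Hence the balls of radius [k / 16] cover
   all words. *)
have cover (v : {ffun T -> bool}) : exists2 c, c \in C & (16 * hamming v c < k)%N.
  apply/exists_inP; apply: contraT; rewrite negb_exists_in => /forall_inP far.
  have far1 c : c \in C -> (k <= 16 * hamming v c)%N by move/far; rewrite -leqNgt.
  have far2 c : c \in C -> (k <= 16 * hamming (neg v) c)%N.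
    move=> cC; have := far1 _ (Cneg _ cC).
    by rewrite hamC hamN hamN hamC.
  have vC : v \notin C by apply/negP => /far1; rewrite ham0; lia.
  suff /Cmax : P (v |: (neg v |: C)).
    rewrite /geq /= leqNgt => /negP[].
    by apply/proper_card/properP; split;
      [apply/fintype.subsetP => c cC; rewrite !inE cC !orbT | exists v => //; rewrite !inE eqxx].
  have vn : (k <= 16 * hamming v (neg v))%N by rewrite hamC hamN ham0; lia.
  apply/andP; split; apply/forall_inP => c; rewrite !inE.
    by case/or3P => [/eqP->|/eqP->|/Cneg ->]; rewrite ?negK ?eqxx ?orbT.
  move=> cC; apply/forall_inP => c'; rewrite !inE => c'C; apply/implyP => cc'.
  case/or3P: cC cc' => [/eqP->|/eqP->|cC];
    case/or3P: c'C => [/eqP->|/eqP->|c'C] cc'; rewrite ?eqxx // in cc' *; auto.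
  - by rewrite hamC.
  - by rewrite hamC; auto.
  - by rewrite hamC; auto.
  - by move/forall_inP: (Csep _ cC) => /(_ _ c'C)/implyP; apply.
exists C; split => //.
- by move=> c c' cC c'C cc'; move/forall_inP: (Csep _ cC) => /(_ _ c'C)/implyP; apply.
- have [c cC _] := cover [ffun=> true].
  rewrite (cardD1 c) cC add1n ltnS (cardD1 (neg c)) !inE Cneg // andbT.
  suff -> : neg c != c by [].
  have /card_gt0P[t _] := T0.
  by apply/eqP => /ffunP/(_ t); rewrite ffunE; case: (c t).
(* Each word of the ball has weight at least [2 ^ (k - k %/ 16)] in [sum_agreement]. *)
have ball (c : {ffun T -> bool}) : (#|[set v : {ffun T -> bool} | 16 * hamming v c < k]|
                * 2 ^ (k - k %/ 16) <= 3 ^ k)%N.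
  rewrite -(sum_agreement c) -sum_nat_const.
  rewrite [X in (_ <= X)%N](bigID (mem [set v : {ffun T -> bool} | 16 * hamming v c < k]%N)) /=.
  apply: leq_trans (leq_addr _ _); apply: leq_sum => v; rewrite inE => vc.
  by rewrite leq_exp2l // -/k; move: vc; clearbody k; lia.
have total : (2 ^ k <= \sum_(c in C) #|[set v : {ffun T -> bool} | 16 * hamming v c < k]|)%N.
  have <- : #|[set: {ffun T -> bool}]%SET| = (2 ^ k)%N.
    by rewrite cardsT card_ffun card_bool.
  have sub : [set: {ffun T -> bool}]%SET \subset
    \bigcup_(c in C) [set v : {ffun T -> bool} | (16 * hamming v c < k)%N].
    by apply/fintype.subsetP => v _; have [c cC vc] := cover v;
       apply/finset.bigcupP; exists c; rewrite ?inE.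
  apply: leq_trans (subset_leq_card sub) _.
  elim/big_rec2: _ => [|c n A _ IH]; first by rewrite cards0.
  by apply: leq_trans (leq_card_setU _ _) _; rewrite leq_add2l.
have le : (2 ^ k * 2 ^ (k - k %/ 16) <= #|C| * 3 ^ k)%N.
  apply: leq_trans (leq_mul total (leqnn _)) _.
  by rewrite big_distrl -sum_nat_const; apply: leq_sum => c _.
rewrite -(leq_pmul2r (expn_gt0 3 k : (0 < 3 ^ k)%N)).
apply: leq_trans le; apply: leq_trans (leq_mul (leqnn _) (expn3_le k)) _.
by rewrite -!expnD leq_exp2l //; lia.
Qed.

(** * Nested classes and towers of levels *)

(* [agree w r x y] says that [x] and [y] lie in the same class of level [r];
   [w r x y] is the bit of the word of [x] at the level-[r] class of [y]. *)
Definition agree {V : finType} (w : nat -> rel V) (r : nat) (x y : V) : bool :=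
  [forall q : 'I_r, forall z, w q x z == w q y z].

Lemma agreeP (V : finType) (w : nat -> rel V) r x y :
  reflect (forall q, (q < r)%N -> w q x =1 w q y) (agree w r x y).
Proof.
apply: (iffP forallP) => [h q qr z|h q].
  by have /forallP/(_ z)/eqP := h (Ordinal qr).
by apply/forallP => z; rewrite h.
Qed.

Lemma agree0 (V : finType) (w : nat -> rel V) x y : agree w 0 x y.
Proof. by apply/agreeP. Qed.

Lemma agree_refl (V : finType) (w : nat -> rel V) r x : agree w r x x.
Proof. by apply/agreeP. Qed.

Lemma agree_sym (V : finType) (w : nat -> rel V) r x y :
  agree w r x y = agree w r y x.
Proof. by apply/agreeP/agreeP => h q qr z; rewrite h. Qed.

Lemma agree_trans (V : finType) (w : nat -> rel V) r x y z :
  agree w r x y -> agree w r y z -> agree w r x z.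
Proof.
by move=> /agreeP h /agreeP h'; apply/agreeP => q qr u; rewrite h // h'.
Qed.

Lemma agree_le (V : finType) (w : nat -> rel V) q r x y :
  (q <= r)%N -> agree w r x y -> agree w q x y.
Proof.
by move=> qr /agreeP h; apply/agreeP => p pq; apply: h; apply: leq_trans qr.
Qed.

Lemma agreeS (V : finType) (w : nat -> rel V) r x y :
  agree w r.+1 x y <-> agree w r x y /\ w r x =1 w r y.
Proof.
split=> [h|[/agreeP h h']].
  by split; [apply: agree_le h | move/agreeP: h; apply].
apply/agreeP => q; rewrite ltnS leq_eqVlt => /orP[/eqP -> //|]; exact: h.
Qed.

Lemma agree_ext (V : finType) (w w' : nat -> rel V) r x y :
  (forall q, (q < r)%N -> w q =2 w' q) -> agree w r x y = agree w' r x y.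
Proof.
move=> ww'; apply/agreeP/agreeP => h q qr z; first by rewrite -!ww' // h.
by rewrite !ww' // h.
Qed.

(** Distances are counted over points of [V], so that a class weighs as much as it has points. The
    map of [tower_bal] reflects that the code is closed under complement; being injective, it
    permits a change of summation variable. *)
Record tower (V : finType) (s : nat) (w : nat -> rel V) : Prop := Tower {
  tower_bits : forall r x y y', (r < s)%N -> agree w r y y' ->
    w r x y = w r x y';
  tower_sep : forall r x x', (r < s)%N -> agree w r x x' ->
    ~~ agree w r.+1 x x' -> (#|V| <= 16 * hamming (w r x) (w r x'))%N;
  tower_bal : forall r, (r < s)%N -> exists2 sigma : V -> V,
    injective sigma &
    forall y, agree w r y (sigma y) /\ forall x, w r (sigma y) x = ~~ w r y x }.

Definition pull {V : finType} (U : finType) (w : nat -> rel V) (r : nat) :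
  rel (V * U)%type := fun x y => w r x.1 y.1.
Arguments pull {V} U w r.

Lemma agree_pull (V U : finType) (w : nat -> rel V) r (x y : V * U) :
  agree (pull U w) r x y = agree w r x.1 y.1.
Proof.
apply/agreeP/agreeP => h q qr; last by move=> z; apply: h.
by move=> z; apply: (h q qr (z, x.2)).
Qed.

Lemma hamming_pull (V U : finType) (w : nat -> rel V) r (x x' : V * U) :
  hamming (pull U w r x) (pull U w r x') =
  (hamming (w r x.1) (w r x'.1) * #|U|)%N.
Proof.
rewrite /hamming -(cardsT U) -cardsX; apply: eq_card => -[v u].
by rewrite !inE andbT.
Qed.

(** Replacing each point by [#|U|] twins multiplies distances and the number of points alike, so the
    constant 16 survives. It serves both to append a new word and to attach a palette. *)
Lemma tower_pull (V U : finType) s (w : nat -> rel V) :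
  tower s w -> tower s (pull U w).
Proof.
move=> tw; split=> [r x y y' rs|r x x' rs|r rs].
- by rewrite agree_pull; exact: (tower_bits tw).
- rewrite !agree_pull hamming_pull card_prod mulnA => h h'.
  by rewrite leq_mul2r (tower_sep tw rs h h') orbT.
- have [sigma inj bal] := tower_bal tw rs.
  exists (fun y => (sigma y.1, y.2)) => [[v u] [v' u'] [/inj -> ->] //|y].
  have [h1 h2] := bal y.1; rewrite agree_pull; split=> // x; exact: h2.
Qed.

Lemma tower_ext (V : finType) s (w w' : nat -> rel V) :
  (forall q, (q < s)%N -> w q =2 w' q) -> tower s w -> tower s w'.
Proof.
move=> ww' tw; have ag r x y : (r <= s)%N -> agree w' r x y = agree w r x y.
  by move=> rs; apply/esym/agree_ext => q qr; apply: ww'; apply: leq_trans rs.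
split=> [r x y y' rs|r x x' rs|r rs].
- by rewrite -!ww' // ag ?(ltnW rs) //; exact: (tower_bits tw).
- rewrite !ag ?(ltnW rs) // => h h'; apply: leq_trans (tower_sep tw rs h h') _.
  rewrite leq_mul2l; apply/orP; right; apply/eq_leq/eq_card => t.
  by rewrite !inE !ww'.
- have [sigma inj bal] := tower_bal tw rs; exists sigma => // y.
  have [h1 h2] := bal y; rewrite ag ?(ltnW rs) //.
  by split=> // x; rewrite -!ww'.
Qed.

(** The classes of level [s] are single points, so a word indexed by classes is a word indexed by
    [V]. The new points are the pairs of an old point and a codeword. *)
Lemma tower_step (V : finType) s (w : nat -> rel V) :
  tower s w -> (forall x y, agree w s x y -> x = y) -> (0 < #|V|)%N ->
  exists (V' : finType) (w' : nat -> rel V'),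
  [/\ tower s.+1 w', forall x y, agree w' s.+1 x y -> x = y,
      (2 * #|V| <= #|V'|)%N & (#|V| * 2 ^ (#|V| %/ 16) <= #|V'|)%N].
Proof.
move=> tw winj V0; have [C [Cneg Csep C2 Cbig]] := code_exists V0.
pose U := {c : {ffun V -> bool} | c \in C}.
have cardU : #|{: U}| = #|C| by rewrite card_sig.
pose w' r : rel (V * U)%type :=
  fun x y => if (r < s)%N then w r x.1 y.1 else val x.2 y.1.
have w'E q : (q < s)%N -> pull U w q =2 w' q by move=> qs x y; rewrite /w' qs.
have w's x y : w' s x y = val x.2 y.1 by rewrite /w' ltnn.
have tw' : tower s w' by apply: tower_ext w'E (tower_pull U tw).
have ags (x y : V * U) : agree w' s x y -> x.1 = y.1.
  rewrite -(agree_ext x y (r := s) w'E) agree_pull; exact: winj.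
have winj' x y : agree w' s.+1 x y -> x = y.
  move=> /agreeS[/ags]; case: x y => x c [y c'] /= <- h; congr pair.
  by apply/val_inj/ffunP => z; have := h (z, c); rewrite !w's.
exists (V * U)%type, w'; split=> //; last 2 first.
- by rewrite card_prod cardU mulnC leq_mul.
- by rewrite card_prod cardU leq_mul.
split=> [r x y y'|r x x'|r]; rewrite ltnS leq_eqVlt => /orP[/eqP->|rs].
- by move/ags => yy'; rewrite !w's yy'.
- exact: (tower_bits tw').
- case: x x' => x c [x' c'] /ags /= xx' /negP ne.
  have cc' : val c != val c'.
    apply/negP => /eqP/val_inj cc'; apply: ne; rewrite xx' cc'; exact: agree_refl.
  have -> : hamming (w' s (x, c)) (w' s (x', c')) = (hamming (val c) (val c') * #|{: U}|)%N.
    rewrite /hamming -(cardsT {: U}) -cardsX; apply: eq_card => -[v u].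
    by rewrite !inE !w's andbT.
  by rewrite card_prod mulnA leq_mul2r Csep ?orbT // (valP c, valP c').
- exact: (tower_sep tw').
- pose neg (c : U) : U := Sub [ffun t => ~~ val c t] (Cneg _ (valP c)).
  exists (fun y => (y.1, neg y.2)) => [|y].
    apply: inv_inj => -[v c]; congr pair; apply/val_inj/ffunP => t.
    by rewrite !ffunE negbK.
  split=> [|x]; last by rewrite !w's ffunE.
  by rewrite -(agree_ext _ _ (r := s) w'E) agree_pull agree_refl.
- exact: (tower_bal tw').
Qed.

(** The factor 16 absorbs the division by 16 in the exponent at each step; four preliminary levels,
    each at least doubling the size, provide it. *)
Lemma tower_exists h :
  exists (V : finType) (w : nat -> rel V),
  [/\ tower (h + 4) w, forall x y, agree w (h + 4) x y -> x = y &
      (16 * twrn h <= #|V|)%N].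
Proof.
have base s : exists (V : finType) (w : nat -> rel V),
    [/\ tower s w, forall x y, agree w s x y -> x = y & (2 ^ s <= #|V|)%N].
  elim: s => [|s [V [w [tw winj big]]]].
    exists unit, (fun _ _ _ => false); split; last by rewrite card_unit.
    - by split.
    - by case=> -[].
  have [|V' [w' [tw' winj' big' _]]] := tower_step tw winj.
    by apply: leq_trans big; rewrite expn_gt0.
  exists V', w'; split=> //; apply: leq_trans big'.
  by rewrite expnS leq_mul.
elim: h => [|h [V [w [tw winj big]]]]; first exact: base.
have V0 : (0 < #|V|)%N.
  by apply: leq_trans big; case: h {tw winj} => //= h; rewrite muln_gt0 expn_gt0.
have [V' [w' [tw' winj' _ big']]] := tower_step tw winj V0.
exists V', w'; rewrite addSn; split=> //; apply: leq_trans big'.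
have twr0 : (0 < twrn h)%N by case: (h) => //= k; rewrite expn_gt0.
apply: leq_mul; first by apply: leq_trans big; rewrite leq_pmulr.
by rewrite leq_exp2l // leq_divRL // mulnC.
Qed.

(** * Weights, averages, and the contribution of each level to a split *)

Definition conflict (R : realType) (V : finType) (w : nat -> rel V) (q : nat)
  (x y : V) : R := (w q x y (+) w q y x)%:R.

Definition weight (R : realType) (V : finType) (s : nat) (w : nat -> rel V)
  (x y : V) : R := s%:R^-1 * \sum_(q < s) conflict R w q x y.

Definition avg (R : realType) (V : finType) (A : {set V}) (phi : V -> R) : R :=
  (\sum_(x in A) phi x) / #|A|%:R.

Definition side (V : finType) (w : nat -> rel V) (r : nat) (Z0 : {set V})
  (y : V) (b : bool) : {set V} := [set x in Z0 | w r x y == b].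

Section Avg.
Variables (R : realType) (V : finType).
Implicit Types (A : {set V}) (phi psi : V -> R).

Lemma eq_avg A phi psi : {in A, phi =1 psi} -> avg A phi = avg A psi.
Proof. by move=> h; rewrite /avg; congr (_ / _); apply: eq_bigr. Qed.

Lemma avg_const A phi c : (0 < #|A|)%N -> {in A, forall x, phi x = c} ->
  avg A phi = c.
Proof.
move=> A0 h; rewrite /avg (eq_bigr (fun=> c)) // sumr_const -[c *+ _]mulr_natr mulfK //.
by rewrite pnatr_eq0 -lt0n.
Qed.

Lemma avg_opp1 A phi : (0 < #|A|)%N -> avg A (fun x => 1 - phi x) = 1 - avg A phi.
Proof.
move=> A0; rewrite /avg sumrB mulrBl; congr (_ - _).
exact: (@avg_const A (fun=> 1) 1).
Qed.

Lemma avg_lincomb A n (c : R) (phi : 'I_n -> V -> R) :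
  avg A (fun x => c * \sum_i phi i x) = \sum_i c * avg A (phi i).
Proof.
by rewrite /avg -!mulr_sumr exchange_big -mulrA mulr_suml.
Qed.

Lemma avg_01 A phi : (forall x, 0 <= phi x <= 1) -> 0 <= avg A phi <= 1.
Proof.
move=> h; rewrite divr_ge0 ?sumr_ge0 //=; last by move=> x _; have /andP[] := h x.
(* The average over the empty set is 0, by the convention for division by 0. *)
have [A0|A0] := posnP #|A|; first by rewrite /avg A0 invr0 mulr0 ler01.
rewrite /avg ler_pdivrMr ?ltr0n // mul1r -sum1_card natr_sum ler_sum // => x _.
by have /andP[] := h x.
Qed.

End Avg.

Lemma weight_01 (R : realType) (V : finType) s (w : nat -> rel V) x y :
  0 <= weight R s w x y <= 1.
Proof.
have h q : 0 <= conflict R w q x y <= 1.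
  by rewrite /conflict; case: (_ (+) _); rewrite ?ler01 ?lexx.
rewrite /weight; apply/andP; split.
  by rewrite mulr_ge0 ?invr_ge0 ?ler0n ?sumr_ge0 // => q _; have /andP[] := h q.
case: s => [|s]; first by rewrite invr0 mul0r ler01.
rewrite mulrC ler_pdivrMr ?ltr0Sn // mul1r.
rewrite -[leRHS](_ : \sum_(q < s.+1) 1 = _); last by rewrite sumr_const card_ord.
by apply: ler_sum => q _; have /andP[] := h q.
Qed.

(* Level [r] contributes [-1 / s] at each point; the levels below [r] are
   constant on [Z0], and the balancing maps cancel the levels above [r]. *)
Lemma split_sum (R : realType) (V : finType) s (w : nat -> rel V) r x0
    (Z0 S : {set V}) :
  tower s w -> (r < s)%N ->
  {in Z0, forall x, agree w r x0 x} ->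
  (forall y b, y \in S -> (0 < #|side w r Z0 y b|)%N) ->
  (forall y y', agree w r y y' -> (y \in S) = (y' \in S)) ->
  \sum_(y in S) (-1) ^+ w r y x0 *
     (avg (side w r Z0 y false) (weight R s w ^~ y) -
      avg (side w r Z0 y true) (weight R s w ^~ y))
  = - (#|S|%:R / s%:R).
Proof.
move=> tw rs Z0x0 S0 Sinv.
pose G q y : R := (-1) ^+ w r y x0 *
     (avg (side w r Z0 y false) (conflict R w q ^~ y) -
      avg (side w r Z0 y true) (conflict R w q ^~ y)).
transitivity (\sum_(q < s) s%:R^-1 * \sum_(y in S) G q y).
  under [RHS]eq_bigr do rewrite mulr_sumr.
  rewrite exchange_big /=; apply: eq_bigr => y _.
  rewrite /weight !avg_lincomb -sumrB mulr_sumr; apply: eq_bigr => q _.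
  by rewrite /G -mulrBr mulrCA.
have sideP y b x : x \in side w r Z0 y b -> x \in Z0 /\ w r x y = b.
  by rewrite inE => /andP[-> /eqP].
have Gr y : y \in S -> G r y = -1.
  move=> yS; have ag b : avg (side w r Z0 y b) (conflict R w r ^~ y) = (b (+) w r y x0)%:R.
    apply: avg_const => [|x /sideP[xZ xb]]; first exact: S0.
    by rewrite /conflict xb -(tower_bits tw _ rs (Z0x0 _ xZ)).
  by rewrite /G !ag; case: (w r y x0); rewrite /= ?expr1 ?expr0; ring.
have Glt q y : (q < r)%N -> y \in S -> G q y = 0.
  move=> qr yS; have ag b : avg (side w r Z0 y b) (conflict R w q ^~ y) = conflict R w q x0 y.
    apply: avg_const => [|x /sideP[xZ xb]]; first exact: S0.
    rewrite /conflict.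
    have /agreeP/(_ _ qr y) -> := Z0x0 _ xZ.
    by rewrite -(tower_bits tw _ (ltn_trans qr rs) (agree_le (ltnW qr) (Z0x0 _ xZ))).
  by rewrite /G !ag subrr mulr0.
have Ggt q : (r < q)%N -> (q < s)%N -> \sum_(y in S) G q y = 0.
  move=> rq qs; have [sigma inj bal] := tower_bal tw qs.
  (* [sigma] preserves [S], the two sides and the sign, as these depend on levels up to [r < q], but
     it flips the bit of [y] at level [q]. Each average becomes one minus itself, and their
     difference changes sign. *)
  suff : \sum_(y in S) G q y = - \sum_(y in S) G q y by lra.
  rewrite [LHS](reindex_inj inj) -sumrN.
  have agr y : agree w r y (sigma y) by apply: agree_le (ltnW rq) (bal y).1.
  rewrite (eq_bigl (mem S)) /=; last by move=> y; rewrite -(Sinv _ _ (agr y)).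
  apply: eq_bigr => y yS.
  have ag b : avg (side w r Z0 (sigma y) b) (conflict R w q ^~ (sigma y)) =
      1 - avg (side w r Z0 y b) (conflict R w q ^~ y).
    rewrite -avg_opp1; last exact: S0.
    have -> : side w r Z0 (sigma y) b = side w r Z0 y b.
      by apply/setP => x; rewrite !inE -(tower_bits tw _ rs (agr y)).
    apply: eq_avg => x _; have [h1 h2] := bal y.
    rewrite /conflict h2 -(tower_bits tw _ qs h1).
    by case: (w q x y); case: (w q y x); rewrite /= ?subr0 ?subrr.
  have -> : G q (sigma y) = (-1) ^+ w r y x0 *
     (avg (side w r Z0 (sigma y) false) (conflict R w q ^~ (sigma y)) -
      avg (side w r Z0 (sigma y) true) (conflict R w q ^~ (sigma y))).
    rewrite /G; congr (_ ^+ _ * _); have /agreeP/(_ _ rq x0) -> // := (bal y).1.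
  by rewrite !ag /G; ring.
rewrite (bigD1 (Ordinal rs)) //= [X in _ + X]big1 => [|q]; last first.
  rewrite -val_eqE /= neq_ltn => /orP[] qr; last by rewrite Ggt ?mulr0.
  by rewrite big1 ?mulr0 // => y; apply: Glt.
rewrite addr0 (eq_bigr (fun=> -1)); last by move=> y; apply: Gr.
by rewrite sumr_const mulNrn mulrN mulrC.
Qed.

(** * Concentration in one class when few coordinates split *)

Lemma card_mem (V : finType) (A : {set V}) (P : pred V) :
  #|[set x in A | P x]| = (\sum_(x in A) P x)%N.
Proof.
rewrite -sum1_card big_mkcond [RHS]big_mkcond /=; apply: eq_bigr => x _.
by rewrite !inE; case: (x \in A); case: (P x).
Qed.

Lemma sum_hamming (V : finType) (w : nat -> rel V) r x1 (A : {set V}) :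
  (\sum_(x in A) hamming (w r x1) (w r x) =
   \sum_y #|[set x in A | w r x1 y != w r x y]|)%N.
Proof.
under [RHS]eq_bigr do rewrite card_mem.
rewrite exchange_big /=; apply: eq_bigr => x _.
by rewrite /hamming -sum1_card big_mkcond; apply: eq_bigr => y _; rewrite inE.
Qed.

(* If a word is at distance [N / 16] from every word outside a class, then
   few splitting coordinates force most of [Z0] into one class: a dominant
   class exists by counting the separated pairs, and then the coordinates at
   which the rest of [Z0] departs from it are mostly splitting. *)
Lemma concentrate (R : realType) (V : finType) s (w : nat -> rel V) r x0
    (Z0 : {set V}) (kappa : R) :
  tower s w -> (r < s)%N -> (0 < #|Z0|)%N ->
  {in Z0, forall x, agree w r x0 x} ->
  0 <= kappa -> 128%:R * kappa <= #|Z0|%:R ->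
  (64 * #|[set y | (kappa <= #|side w r Z0 y false|%:R)%R &&
                   (kappa <= #|side w r Z0 y true|%:R)%R]| <= #|V|)%N ->
  exists2 x1, x1 \in Z0 &
    #|[set x in Z0 | ~~ agree w r.+1 x1 x]|%:R <= 32%:R * kappa.
Proof.
move=> tw rs Z00 Z0x0 k0 kz; set S := [set y | _]%SET => hS.
have V0 : (0 < #|V|)%N by apply: leq_trans Z00 (max_card _).
set N : R := #|V|%:R; have N0 : 0 < N by rewrite ltr0n.
set z : R := #|Z0|%:R in kz *; have z0 : 0 < z by rewrite ltr0n.
have hSR : 64%:R * #|S|%:R <= N by rewrite -natrM ler_nat.
pose rest x1 := [set x in Z0 | ~~ agree w r.+1 x1 x]%SET.
have far x1 x : x1 \in Z0 -> x \in rest x1 ->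
    N <= 16%:R * (hamming (w r x1) (w r x))%:R.
  move=> x1Z; rewrite inE => /andP[xZ nag]; rewrite -natrM ler_nat.
  apply: (tower_sep tw rs) nag; apply: agree_trans (Z0x0 _ xZ).
  by rewrite agree_sym Z0x0.
have farsum x1 (A : {set V}) : x1 \in Z0 -> A \subset rest x1 ->
    N * #|A|%:R <= 16%:R * \sum_y #|[set x in A | w r x1 y != w r x y]|%:R.
  move=> x1Z Ar; rewrite -natr_sum -sum_hamming natr_sum mulr_sumr mulr_natr.
  rewrite -sumr_const; apply: ler_sum => x xA.
  by apply: far => //; apply: (fintype.subsetP Ar).
have Ssum (F : V -> R) (a b : R) : 0 <= b ->
    (forall y, y \in S -> F y <= a) ->
    (forall y, y \notin S -> F y <= b) ->
    \sum_y F y <= #|S|%:R * a + N * b.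
  move=> b0 Fa Fb; rewrite (bigID (mem S)) /= lerD //.
    by rewrite mulr_natl -sumr_const; apply: ler_sum.
  apply: (@le_trans _ _ (\sum_(y | y \notin S) b)); first exact: ler_sum.
  rewrite sumr_const -[_ *+ _]mulr_natl ler_wpM2r // ler_nat.
  by apply: max_card.
have sideN y : y \notin S ->
    exists2 b, #|side w r Z0 y b|%:R <= kappa & #|side w r Z0 y (~~ b)|%:R <= z.
  have le b : (#|side w r Z0 y b|%:R : R) <= z.
    by rewrite ler_nat subset_leq_card //; apply/fintype.subsetP => x; rewrite inE => /andP[].
  by rewrite inE negb_and -!ltNge => /orP[]/ltW h; [exists false|exists true].
(* Otherwise more than [z ^ 2 / 2] ordered pairs lie in different classes. A coordinate in [S]
   separates at most [z ^ 2] pairs and any other at most [2 * kappa * z]. With [#|S| <= N / 64] and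
   [kappa <= z / 128], the code distance allows at most [16 * (1 / 64 + 1 / 64) * z ^ 2] such
   pairs. *)
have [x1 x1Z hx1] : exists2 x1, x1 \in Z0 & 2%:R * #|rest x1|%:R <= z.
  apply/exists_inP; apply: contraT; rewrite negb_exists_in => /forall_inP big.
  have lo : \sum_(x1 in Z0) z < \sum_(x1 in Z0) 2%:R * #|rest x1|%:R.
    have /card_gt0P[x1 x1Z] := Z00.
    rewrite (bigD1 x1) //= [ltRHS](bigD1 x1) //= ltr_leD //.
      by have := big _ x1Z; rewrite -ltNge.
    by apply: ler_sum => x /andP[/big]; rewrite -ltNge => /ltW.
  rewrite sumr_const -mulr_natl -/z -mulr_sumr in lo.
  have up : N * \sum_(x1 in Z0) #|rest x1|%:R <=
      16%:R * \sum_y \sum_(x1 in Z0) #|[set x in Z0 | w r x1 y != w r x y]|%:R.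
    rewrite exchange_big /= !mulr_sumr; apply: ler_sum => x1 x1Z.
    apply: le_trans (farsum _ _ x1Z (fintype.subxx _)) _.
    rewrite ler_pM2l ?ltr0n //; apply: ler_sum => y _.
    rewrite ler_nat subset_leq_card //; apply/fintype.subsetP => x.
    by rewrite !inE => /andP[/andP[-> _] ->].
  have up2 : \sum_y \sum_(x1 in Z0) #|[set x in Z0 | w r x1 y != w r x y]|%:R
      <= #|S|%:R * (z * z) + N * (2%:R * kappa * z).
    apply: Ssum => [|y _|y /sideN[b b1 b2]]; first by rewrite !mulr_ge0 ?(ltW z0).
      rewrite {1}/z mulr_natl -sumr_const; apply: ler_sum => x1 _.
      by rewrite ler_nat subset_leq_card //; apply/fintype.subsetP => x; rewrite inE => /andP[].
    have -> : \sum_(x1 in Z0) (#|[set x in Z0 | w r x1 y != w r x y]|%:R : R) =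
        \sum_(x1 in side w r Z0 y b) #|side w r Z0 y (~~ b)|%:R +
        \sum_(x1 in side w r Z0 y (~~ b)) #|side w r Z0 y b|%:R.
      rewrite (bigID (fun x1 => w r x1 y == b)) /=; congr (_ + _).
        apply: eq_big => x1; first by rewrite !inE.
        move=> /andP[_ /eqP->]; congr (_%:R); apply: eq_card => x; rewrite !inE.
        by case: (b); case: (w r x y).
      apply: eq_big => x1; first by rewrite !inE; case: (b); case: (w r x1 y).
      move=> /andP[_ h]; congr (_%:R); apply: eq_card => x; rewrite !inE.
      by move: h; case: (b); case: (w r x y); case: (w r x1 y).
    rewrite !sumr_const -[X in X + _]mulr_natr -[X in _ + X]mulr_natr.
    have := ler_pM (ler0n _ _) (ler0n _ _) b1 b2; lra.
  have kz2 : N * (2%:R * kappa * z) <= N * (z * z) / 64%:R.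
    have : kappa * z <= z / 128%:R * z by rewrite ler_wpM2r ?(ltW z0) //; lra.
    move=> /(ler_wpM2l (ltW N0)); lra.
  have Sz : #|S|%:R * (z * z) <= N * (z * z) / 64%:R.
    have : #|S|%:R * (z * z) <= N / 64%:R * (z * z).
      by rewrite ler_wpM2r ?mulr_ge0 ?(ltW z0) //; lra.
    lra.
  move: lo; rewrite -(ltr_pM2l N0) => lo.
  lra.
exists x1 => //; rewrite -/(rest x1).
have := farsum _ _ x1Z (fintype.subxx (rest x1)).
set rho : R := #|rest x1|%:R in hx1 *; have rho0 : 0 <= rho by rewrite ler0n.
have up : \sum_y #|[set x in rest x1 | w r x1 y != w r x y]|%:R
    <= #|S|%:R * rho + N * kappa.
  apply: Ssum => // y yS.
    by rewrite ler_nat subset_leq_card //; apply/fintype.subsetP => x; rewrite inE => /andP[].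
  have [b b1 b2] := sideN _ yS.
  (* The class of [x1] holds at least half of [Z0], so it cannot lie on the small side; hence
     whatever differs from [x1] at [y] does. *)
  have [h|h] := eqVneq (w r x1 y) b.
    have : z - rho <= #|side w r Z0 y b|%:R.
      rewrite lerBlDr -natrD ler_nat /rest -{1}(cardsID (rest x1) Z0) addnC leq_add //.
        apply/subset_leq_card/fintype.subsetP => x; rewrite !inE.
        case: (x \in Z0) => //=; rewrite andbT negbK => /agreeS[_ e].
        by rewrite -e h.
      by apply/subset_leq_card/subsetIr.
    lra.
  apply: le_trans b1; rewrite ler_nat subset_leq_card //.
  apply/fintype.subsetP => x; rewrite !inE => /andP[/andP[-> _]].
  by move: h; case: (b); case: (w r x y); case: (w r x1 y).
move=> lo; have Srho : #|S|%:R * rho <= N * rho / 64%:R.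
  have : #|S|%:R * rho <= N / 64%:R * rho by rewrite ler_wpM2r //; lra.
  lra.
have : N * rho <= N * (32%:R * kappa) by have := mulr_ge0 (ltW N0) k0; lra.
by rewrite ler_pM2l.
Qed.

(** * Calm pairs and the induction over the levels *)

(** This is what regularity leaves once the graph is replaced by the weight [p]. The factor 4
    allows, for each of [A0] and [A1], one [eps] for regularity and one for the discrepancy. *)
Definition calm (R : realType) (V : finType) (eps : R) (p : V -> V -> R)
    (A B : {set V}) : Prop :=
  forall A0 A1 B0 : {set V}, A0 \subset A -> A1 \subset A -> B0 \subset B ->
    eps * #|A|%:R <= #|A0|%:R -> eps * #|A|%:R <= #|A1|%:R ->
    eps * #|B|%:R <= #|B0|%:R ->
    `|\sum_(y in B0) (avg A0 (p^~ y) - avg A1 (p^~ y))| <= 4%:R * eps * #|B0|%:R.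

Definition concentrated (R : realType) (V : finType) (w : nat -> rel V) r
    (a : R) (A : {set V}) : Prop :=
  exists x0, (1 - a) * #|A|%:R <= #|[set x in A | agree w r x0 x]|%:R.

Lemma norm_sum_le_card (R : realType) (V : finType) (A : {set V}) (F : V -> R) :
  (forall y, `|F y| <= 1) -> `|\sum_(y in A) F y| <= #|A|%:R.
Proof.
move=> F1; apply: le_trans (ler_norm_sum _ _ _) _.
by rewrite -sum1_card natr_sum; apply: ler_sum.
Qed.

Lemma sum_sides (R : realType) (V : finType) (A : {set V}) (P : pred V)
    (F : V -> R) :
  \sum_(y in A) F y = \sum_(y in [set y in A | P y]) F y +
                      \sum_(y in [set y in A | ~~ P y]) F y.
Proof.
by rewrite (bigID P) /=; congr (_ + _); apply: eq_bigl => y; rewrite !inE.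
Qed.

Lemma card_sides (V : finType) (A : {set V}) (P : pred V) :
  (#|[set y in A | P y]| + #|[set y in A | ~~ P y]| = #|A|)%N.
Proof.
rewrite -(cardsID [set y | P y] A); congr (_ + _)%N; apply: eq_card => y.
  by rewrite !inE.
by rewrite !inE andbC.
Qed.

(** Since [B] lies in one class, all its points induce the same two sides. The sign cuts [B] into
    two pieces; a piece smaller than [eps * #|B'|] is bounded trivially and a larger one by
    calmness, whence [4 + 1 + 1 = 6]. *)
Lemma calm_part (R : realType) (V : finType) s (w : nat -> rel V) r x0 yB
    (eps : R) (A B Z0 : {set V}) :
  tower s w -> (r < s)%N -> 0 <= eps -> Z0 \subset A ->
  (forall b, eps * #|A|%:R <= #|side w r Z0 yB b|%:R) ->
  B = [set y in B | agree w r yB y] ->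
  forall B' : {set V}, B \subset B' -> calm eps (weight R s w) A B' ->
  `|\sum_(y in B) (-1) ^+ w r y x0 *
     (avg (side w r Z0 y false) (weight R s w ^~ y) -
      avg (side w r Z0 y true) (weight R s w ^~ y))| <= 6%:R * eps * #|B'|%:R.
Proof.
move=> tw rs e0 Z0A sA BB B' BB' cal.
pose g y : R := avg (side w r Z0 yB false) (weight R s w ^~ y) -
                avg (side w r Z0 yB true) (weight R s w ^~ y).
have g1 y : `|g y| <= 1.
  have := avg_01 (side w r Z0 yB false) (fun x => weight_01 R s w x y).
  have := avg_01 (side w r Z0 yB true) (fun x => weight_01 R s w x y).
  rewrite /g ler_norml; lra.
have sub b : side w r Z0 yB b \subset A.
  by apply: fintype.subset_trans Z0A; apply/fintype.subsetP => x; rewrite inE => /andP[].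
have piece (Y : {set V}) : Y \subset B ->
    `|\sum_(y in Y) g y| <= 4%:R * eps * #|Y|%:R + eps * #|B'|%:R.
  move=> YB; have YB' := fintype.subset_trans YB BB'.
  have [big|small] := leP (eps * #|B'|%:R) (#|Y|%:R).
    by have := cal _ _ _ (sub false) (sub true) YB' (sA _) (sA _) big;
      have : 0 <= eps * #|B'|%:R by [rewrite mulr_ge0]; rewrite /g; lra.
  apply: le_trans (norm_sum_le_card _ g1) _.
  have : 0 <= eps * #|Y|%:R by rewrite mulr_ge0.
  by move: small; lra.
have sE y b : agree w r yB y -> side w r Z0 y b = side w r Z0 yB b.
  by move=> ag; apply/setP => x; rewrite !inE (tower_bits tw _ rs ag).
rewrite (sum_sides B (fun y => w r y x0)).
set B1 := [set y in B | w r y x0]%SET; set B2 := [set y in B | ~~ w r y x0]%SET.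
have E1 : \sum_(y in B1) (-1) ^+ w r y x0 *
     (avg (side w r Z0 y false) (weight R s w ^~ y) -
      avg (side w r Z0 y true) (weight R s w ^~ y)) = - \sum_(y in B1) g y.
  rewrite -sumrN; apply: eq_bigr => y; rewrite inE BB inE => /andP[/andP[_ ag] ->].
  by rewrite expr1 mulN1r !sE.
have E2 : \sum_(y in B2) (-1) ^+ w r y x0 *
     (avg (side w r Z0 y false) (weight R s w ^~ y) -
      avg (side w r Z0 y true) (weight R s w ^~ y)) = \sum_(y in B2) g y.
  apply: eq_bigr => y; rewrite inE BB inE => /andP[/andP[_ ag] /negbTE ->].
  by rewrite expr0 mul1r !sE.
rewrite E1 E2 addrC; apply: le_trans (ler_normB _ _) _.
have p1 : `|\sum_(y in B1) g y| <= 4%:R * eps * #|B1|%:R + eps * #|B'|%:R.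
  by apply: piece; apply/fintype.subsetP => y; rewrite inE => /andP[].
have p2 : `|\sum_(y in B2) g y| <= 4%:R * eps * #|B2|%:R + eps * #|B'|%:R.
  by apply: piece; apply/fintype.subsetP => y; rewrite inE => /andP[].
have cB : #|B1|%:R + #|B2|%:R <= #|B'|%:R :> R.
  by rewrite -natrD card_sides ler_nat subset_leq_card.
have := ler_wpM2l e0 cB; lra.
Qed.

(** The signed sum of [split_sum] is estimated part by part: the points off the main class of each
    part cost [a], the main classes of calm parts [6 * eps], and the parts in [D] together
    [2 * eps]. *)
Lemma split_bound (R : realType) (V : finType) s (w : nat -> rel V) r x0
    (eps a : R) (P D : {set {set V}}) (A : {set V}) :
  tower s w -> (r < s)%N -> 0 < eps -> 0 <= a ->
  finset.partition P [set: V]%SET -> A \in P ->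
  (forall B, B \in P -> concentrated w r a B) ->
  (forall B, B \in P -> B \notin D -> calm eps (weight R s w) A B) ->
  \sum_(B in P | B \in D) #|B|%:R <= 2%:R * eps * #|V|%:R ->
  let Z0 := [set x in A | agree w r x0 x]%SET in
  let S := [set y | (eps * #|A|%:R <= #|side w r Z0 y false|%:R) &&
                    (eps * #|A|%:R <= #|side w r Z0 y true|%:R)]%SET in
  is_true (#|S|%:R / s%:R <= (a + 8%:R * eps) * #|V|%:R).
Proof.
move=> tw rs e0 a0 partP AP conc calP sumD Z0 S.
have A0 : (0 < #|A|)%N.
  rewrite card_gt0; apply/eqP => AE.
  by have /and3P[_ _] := partP; rewrite -AE AP.
have eA : 0 < eps * #|A|%:R by rewrite mulr_gt0 ?ltr0n.
have sideS y b : y \in S -> eps * #|A|%:R <= #|side w r Z0 y b|%:R.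
  by rewrite inE => /andP[h1 h2]; case: b.
have sideE y y' : agree w r y y' -> side w r Z0 y =1 side w r Z0 y'.
  by move=> ag b; apply/setP => x; rewrite !inE (tower_bits tw _ rs ag).
have Sinv y y' : agree w r y y' -> (y \in S) = (y' \in S).
  by move=> ag; rewrite !inE !(sideE _ _ ag).
pose F y : R := (-1) ^+ w r y x0 *
     (avg (side w r Z0 y false) (weight R s w ^~ y) -
      avg (side w r Z0 y true) (weight R s w ^~ y)).
have F1 y : `|F y| <= 1.
  rewrite /F normrM normrX normrN1 expr1n mul1r ler_norml.
  have := avg_01 (side w r Z0 y false) (fun x => weight_01 R s w x y).
  have := avg_01 (side w r Z0 y true) (fun x => weight_01 R s w x y).
  lra.
have total : \sum_(y in S) F y = - (#|S|%:R / s%:R).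
  apply: (@split_sum R V s w r x0 Z0 S) => //.
    by move=> x; rewrite inE => /andP[].
  by move=> y b /(sideS y b) h; rewrite -(ltr0n R); apply: lt_le_trans h.
have normt : `|\sum_(y in S) F y| = #|S|%:R / s%:R.
  by rewrite total normrN ger0_norm // divr_ge0.
have sumP (f : V -> R) : \sum_y f y = \sum_(B in P) \sum_(y in B) f y.
  by rewrite -(set_partition_big _ partP) /=; apply: eq_bigl => y; rewrite inE.
rewrite -normt big_mkcond sumP.
apply: le_trans (ler_norm_sum _ _ _) _.
have each B : B \in P -> `|\sum_(y in B) (if y \in S then F y else 0)| <=
    (a + 6%:R * eps) * #|B|%:R + (if B \in D then #|B|%:R else 0).
  move=> BP; have [yB hyB] := conc _ BP.
  pose G y := if y \in S then F y else 0;
  rewrite -[X in `|X|]/(\sum_(y in B) G y); have G1 y : `|G y| <= 1.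
    by rewrite /G; case: ifP; rewrite ?normr0 ?ler01.
  rewrite (sum_sides B (agree w r yB)).
  set Bi := [set y in B | agree w r yB y]%SET in hyB *.
  set Bo := [set y in B | ~~ agree w r yB y]%SET.
  have io : #|Bi|%:R + #|Bo|%:R = #|B|%:R :> R by rewrite -natrD card_sides.
  have ho : `|\sum_(y in Bo) G y| <= a * #|B|%:R.
    apply: le_trans (norm_sum_le_card _ G1) _; lra.
  suff hi : `|\sum_(y in Bi) G y| <=
      6%:R * eps * #|B|%:R + (if B \in D then #|B|%:R else 0).
    by apply: le_trans (ler_normD _ _) _; lra.
  have e6 : 0 <= 6%:R * eps * #|B|%:R by rewrite !mulr_ge0 // ltW.
  case: ifP => BD.
    apply: le_trans (norm_sum_le_card _ G1) _.
    have : 0 <= #|Bo|%:R :> R by [].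
    by move: io e6; lra.
  (* [S] is a union of classes of level [r], so the main class is inside [S] or disjoint from it. *)
  rewrite addr0; have [yS|yS] := boolP (yB \in S); last first.
    rewrite big1 ?normr0 // => y; rewrite inE => /andP[_ /Sinv e].
    by rewrite /G -e (negbTE yS).
  have -> : \sum_(y in Bi) G y = \sum_(y in Bi) F y.
    by apply: eq_bigr => y; rewrite inE => /andP[_ /Sinv e]; rewrite /G -e yS.
  apply: (@calm_part R V s w r x0 yB eps A Bi Z0 tw rs (ltW e0)).
  - by apply/fintype.subsetP => x; rewrite inE => /andP[].
  - by move=> b; apply: sideS.
  - by apply/setP => y; rewrite !inE; case: (y \in B) => //=; rewrite andbb.
  - by apply/fintype.subsetP => x; rewrite inE => /andP[].
  - by apply: calP; rewrite ?BD.
apply: le_trans (ler_sum _ each) _.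
rewrite big_split /= -mulr_sumr -big_mkcondr /=.
have -> : \sum_(B in P) #|B|%:R = #|V|%:R :> R.
  by rewrite -natr_sum -(card_partition partP) cardsT.
lra.
Qed.

(** If at most [#|V| / 64] coordinates split, [concentrate] with [kappa = eps * #|A|] loses a
    further [32 * eps]. If more do, [split_bound] gives [1 < 64 * s * (32 * r + 8) * eps], which is
    excluded since [2560 = 64 * 40]. *)
Lemma concentrated_all (R : realType) (V : finType) s (w : nat -> rel V)
    (eps : R) (P : {set {set V}}) :
  tower s w -> 0 < eps -> 2560%:R * s%:R * s%:R * eps < 1 ->
  finset.partition P [set: V]%SET ->
  (forall A, A \in P -> exists D : {set {set V}},
     (forall B, B \in P -> B \notin D -> calm eps (weight R s w) A B) /\
     \sum_(B in P | B \in D) #|B|%:R <= 2%:R * eps * #|V|%:R) ->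
  forall r, (r <= s)%N -> forall A, A \in P ->
    concentrated w r (32%:R * r%:R * eps) A.
Proof.
move=> tw e0 small partP calP; elim=> [|r IH] rs A AP.
all: have /finset.set0Pn[xA xAA] : A != finset.set0 by
  apply/eqP => AE; have /and3P[_ _] := partP; rewrite -AE AP.
  exists xA; rewrite mulr0 mul0r subr0 mul1r ler_nat subset_leq_card //.
  by apply/fintype.subsetP => x xA'; rewrite inE xA' agree0.
have A0 : (0 < #|A|)%N by apply/card_gt0P; exists xA.
have V0 : (0 < #|V|)%N by apply/card_gt0P; exists xA.
have [x0 hx0] := IH (ltnW rs) A AP; have [D [calD sumD]] := calP A AP.
have s1 : 1 <= s%:R :> R by rewrite ler1n; apply: leq_ltn_trans rs.
have rsR : r%:R + 1 <= s%:R :> R by rewrite natr1 ler_nat.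
have r0 : 0 <= r%:R :> R by [].
have se : s%:R * eps <= s%:R * s%:R * eps.
  by rewrite ler_pM2r // ler_peMr // (le_trans ler01).
have re : r%:R * eps + eps <= s%:R * eps.
  by rewrite -[X in _ + X]mul1r -mulrDl ler_pM2r.
have e1 : eps <= s%:R * eps by rewrite ler_peMl // ltW.
have re0 : 0 <= r%:R * eps by rewrite mulr_ge0 // ltW.
set Z0 := [set x in A | agree w r x0 x]%SET in hx0.
have aA : 0 < #|A|%:R :> R by rewrite ltr0n.
have hz : 128%:R * (eps * #|A|%:R) <= #|Z0|%:R.
  apply: le_trans hx0; rewrite mulrA ler_pM2r //; lra.
have Z00 : (0 < #|Z0|)%N.
  by rewrite -(ltr0n R); apply: lt_le_trans hz; rewrite !mulr_gt0.
have := split_bound x0 (a := 32%:R * r%:R * eps) tw rs e0 _ partP AP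
  (IH (ltnW rs)) calD sumD.
rewrite -/Z0 /= -mulrA; set S := [set y | _]%SET => bnd.
have [hS|hS] := leqP (64 * #|S|)%N #|V|.
  have Z0x0 : {in Z0, forall x, agree w r x0 x} by move=> x; rewrite inE => /andP[].
  have kappa0 : 0 <= eps * #|A|%:R by rewrite mulr_ge0 // ltW.
  have [x1 x1Z hx1] := concentrate tw rs Z00 Z0x0 kappa0 hz hS.
  exists x1; set rest := [set x in Z0 | _]%SET in hx1.
  have cZ := card_sides Z0 (agree w r.+1 x1); rewrite -/rest in cZ.
  have cZR : #|[set x in Z0 | agree w r.+1 x1 x]|%:R + #|rest|%:R = #|Z0|%:R :> R.
    by rewrite -natrD cZ.
  have : #|[set x in Z0 | agree w r.+1 x1 x]|%:R <=
         #|[set x in A | agree w r.+1 x1 x]|%:R :> R.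
    rewrite ler_nat subset_leq_card //; apply/fintype.subsetP => x.
    by rewrite !inE => /andP[/andP[-> _] ->].
  rewrite -natr1; lra.
have V0R : 0 < #|V|%:R :> R by rewrite ltr0n.
have hSR : #|V|%:R < 64%:R * #|S|%:R :> R by rewrite -natrM ltr_nat.
have {}bnd := bnd (mulr_ge0 (ler0n _ _) re0).
exfalso.
have : #|V|%:R < 64%:R * ((32%:R * (r%:R * eps) + 8%:R * eps) * #|V|%:R * s%:R).
  apply: lt_le_trans hSR _; rewrite ler_pM2l ?ltr0n //.
  by rewrite -ler_pdivrMr // (lt_le_trans ltr01).
apply/negP; rewrite -leNgt; set X := _ + _.
rewrite (_ : _ * _ = 64%:R * (X * s%:R) * #|V|%:R); last by ring.
rewrite -[leRHS]mul1r ler_pM2r //; rewrite /X.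
have : (32%:R * (r%:R * eps) + 8%:R * eps) * s%:R <= 40%:R * (s%:R * eps) * s%:R.
  by rewrite ler_pM2r ?(lt_le_trans ltr01) //; lra.
lra.
Qed.

(** * The quasirandom colouring and the discrepancy of the blow-up *)

(** Translating the value of [phi] at [i] permutes the functions and leaves [phi j] fixed; the sum
    over all translations vanishes because [G] has sum 0. *)
Lemma cross_sum0 (R : realType) (I : finType) (t : nat) (i j : I)
    (G H : 'I_t.+1 -> R) :
  i != j -> \sum_c G c = 0 ->
  \sum_(phi : {ffun I -> 'I_t.+1}) G (phi i) * H (phi j) = 0.
Proof.
move=> ij G0; set X := LHS.
pose shift c (phi : {ffun I -> 'I_t.+1}) : {ffun I -> 'I_t.+1} :=
  [ffun k => if k == i then phi k + c else phi k].
have shift_inj c : injective (shift c).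
  move=> phi psi /ffunP e; apply/ffunP => k; have := e k; rewrite !ffunE.
  by case: ifP => // _ /addIr.
have Xc c : X = \sum_(phi : {ffun I -> 'I_t.+1}) G (phi i + c) * H (phi j).
  rewrite /X (reindex_inj (shift_inj c)); apply: eq_bigr => phi _.
  by rewrite !ffunE eqxx eq_sym (negbTE ij).
have : \sum_(c : 'I_t.+1) X = 0.
  under eq_bigr => c _ do rewrite (Xc c).
  rewrite exchange_big big1 // => phi _; rewrite -mulr_suml.
  suff -> : \sum_c G (phi i + c) = 0 by rewrite mul0r.
  by rewrite -[RHS]G0 [RHS](reindex_inj (@addrI _ (phi i))).
by rewrite sumr_const card_ord => /eqP; rewrite mulrn_eq0 => /eqP.
Qed.

(* For fixed [i] and points [v], [v'] with [v.1 != v'.1], the colours of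
   [(i, phi)] with [v] and with [v'] are independent and uniform in [phi]. *)
Definition palette (n t : nat) : finType :=
  ('I_n * {ffun 'I_n -> 'I_t.+1})%type.

Definition colour (n t : nat) (u v : palette n t) : 'I_t.+1 :=
  u.2 v.1 + v.2 u.1.

Lemma colourC n t (u v : palette n t) : colour u v = colour v u.
Proof. exact: addrC. Qed.

Section Blowup.
Variables (R : realType) (V : finType) (w : nat -> rel V) (n t : nat).
Hypotheses (V0 : (0 < #|V|)%N) (n0 : (0 < n)%N).
Let W : finType := (V * palette n t)%type.

Definition blow_adj : rel W := fun a b =>
  w (colour a.2 b.2) a.1 b.1 (+) w (colour a.2 b.2) b.1 a.1.

Lemma blow_adj_sym : symmetric blow_adj.
Proof. by move=> a b; rewrite /blow_adj colourC addbC. Qed.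

Lemma blow_adj_irrefl : irreflexive blow_adj.
Proof. by move=> a; rewrite /blow_adj addbb. Qed.

Let excess (a b : W) : R :=
  conflict R w (colour a.2 b.2) a.1 b.1 - weight R t.+1 w a.1 b.1.

Let excess_le1 a b : `|excess a b| <= 1.
Proof.
have := weight_01 R t.+1 w a.1 b.1.
have : 0 <= conflict R w (colour a.2 b.2) a.1 b.1 <= 1.
  by rewrite /conflict; case: (_ (+) _); rewrite ?ler01 ?lexx.
rewrite /excess ler_norml; lra.
Qed.

(** With the point and the index of [a] fixed, the two excesses depend on different values of its
    function. Each has mean 0, as the weight is the mean conflict over all colours. *)
Let excess_orth (b b' : W) : b.2.1 != b'.2.1 ->
  \sum_a excess a b * excess a b' = 0.
Proof.
move=> bb'; rewrite -(pair_bigA _ (fun x u => excess (x, u) b * excess (x, u) b')) /=.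
rewrite big1 // => x _.
rewrite -(pair_bigA _ (fun i phi => excess (x, (i, phi)) b * excess (x, (i, phi)) b')) /=.
rewrite big1 // => i _.
pose G (b : W) c : R := conflict R w (c + b.2.2 i)%R x b.1 - weight R t.+1 w x b.1.
apply: (@cross_sum0 R 'I_n t b.2.1 b'.2.1 (G b) (G b') bb').
rewrite /G sumrB.
have <- : \sum_(c : 'I_t.+1) conflict R w c x b.1 =
    \sum_(c : 'I_t.+1) conflict R w (c + b.2.2 i)%R x b.1.
  by rewrite (reindex_inj (@addIr _ (b.2.2 i))).
by rewrite sumr_const card_ord /weight -[X in _ - X]mulr_natl mulrA divff ?mul1r ?subrr //.
Qed.

(** In the expanded square only pairs [b], [b'] with equal index survive, a proportion [1 / n] of
    all pairs, and each contributes at most [#|W|]. *)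
Let second_moment (B : {set W}) :
  n%:R * \sum_a (\sum_(b in B) excess a b) ^+ 2 <= (#|W| ^ 3)%:R.
Proof.
have fiber j : (n * #|[set b : W | b.2.1 == j]| = #|W|)%N.
  have -> : [set b : W | b.2.1 == j] =
      finset.setX [set: V]%SET (finset.setX [set j]%SET [set: {ffun 'I_n -> 'I_t.+1}]%SET).
    by apply/setP => -[x [i phi]]; rewrite !inE /= andbT.
  rewrite !cardsX !cardsT cards1 mul1n !card_prod card_ord mulnCA; lia.
have expand : \sum_a (\sum_(b in B) excess a b) ^+ 2 =
    \sum_(b in B) \sum_(b' in B) \sum_a excess a b * excess a b'.
  under eq_bigr => a _ do rewrite expr2 big_distrlr /=.
  by rewrite exchange_big /=; apply: eq_bigr => b _; rewrite exchange_big.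
have row b : n%:R * \sum_(b' in B) \sum_a excess a b * excess a b' <= #|W|%:R * #|W|%:R.
  rewrite (bigID (fun b' => b'.2.1 == b.2.1)) /= [X in _ + X]big1 ?addr0; last first.
    by move=> b' /andP[_ bb']; rewrite excess_orth // eq_sym.
  apply: (@le_trans _ _ (n%:R * (#|[set b' : W | b'.2.1 == b.2.1]|%:R * #|W|%:R))).
    rewrite ler_pM2l ?ltr0n // mulr_natl -sumr_const.
    apply: (@le_trans _ _ (\sum_(b' | (b' \in B) && (b'.2.1 == b.2.1)) #|W|%:R)).
      apply: ler_sum => b' _; rewrite -sum1_card natr_sum; apply: ler_sum => a _.
      apply: le_trans (ler_norm _) _; rewrite normrM.
      by rewrite -[leRHS]mulr1 ler_pM ?excess_le1.
    rewrite [leRHS](bigID (mem B)) /= [leLHS](eq_bigl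
      (fun b' => (b' \in [set b'0 : W | b'0.2.1 == b.2.1]) && (b' \in B))).
      by rewrite lerDl sumr_ge0.
    by move=> b'; rewrite inE andbC.
  by rewrite mulrA -natrM fiber.
rewrite expand mulr_sumr; apply: (@le_trans _ _ (\sum_(b in B) #|W|%:R * #|W|%:R)).
  by apply: ler_sum => b _.
rewrite sumr_const -[X in X <= _]mulr_natl natrX !exprS expr0 mulr1 ler_wpM2r ?mulr_ge0 //.
by rewrite ler_nat max_card.
Qed.

Lemma blow_discrepancy (delta : R) (A B : {set W}) :
  0 < delta -> delta ^- 2 <= n%:R ->
  `|(\sum_(a in A) \sum_(b in B) (blow_adj a b)%:R) -
    \sum_(a in A) \sum_(b in B) weight R t.+1 w a.1 b.1|
    <= delta * #|W|%:R ^+ 2.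
Proof.
move=> d0 dn; have W0 : 0 < #|W|%:R :> R.
  by rewrite ltr0n !card_prod card_ffun !card_ord !muln_gt0 V0 n0 expn_gt0.
set M : R := #|W|%:R in W0 *.
have -> : \sum_(a in A) \sum_(b in B) (blow_adj a b)%:R -
    \sum_(a in A) \sum_(b in B) weight R t.+1 w a.1 b.1 =
    \sum_(a in A) \sum_(b in B) excess a b.
  by rewrite -sumrB; apply: eq_bigr => a _; rewrite -sumrB.
apply: le_trans (ler_norm_sum _ _ _) _.
have dM : 0 < 2%:R * (delta * M) by rewrite !mulr_gt0.
(* This replaces the Cauchy-Schwarz inequality; with the scale [delta * M] both terms sum to at most
   [delta * M ^ 2 / 2]. *)
have amgm (x : R) : `|x| <= (x ^+ 2 + (delta * M) ^+ 2) / (2%:R * (delta * M)).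
  rewrite ler_pdivlMr //; have := sqr_ge0 (`|x| - delta * M).
  rewrite -[x ^+ 2]real_normK ?num_real //; lra.
apply: (@le_trans _ _ (\sum_a `|\sum_(b in B) excess a b|)).
  by rewrite [leRHS](bigID (mem A)) /= lerDl sumr_ge0.
apply: le_trans (ler_sum _ (fun a _ => amgm _)) _.
rewrite -mulr_suml big_split /= sumr_const -[X in _ + X]mulr_natl -/M.
have := second_moment B; rewrite natrX -/M; set Q := \sum_a _ => hQ.
have hn : 1 <= n%:R * delta ^+ 2.
  by move: dn; rewrite -[X in X <= _]mul1r ler_pdivrMr ?exprn_gt0.
have n0R : 0 < n%:R :> R by rewrite ltr0n.
have hM : M ^+ 3 <= n%:R * delta ^+ 2 * M ^+ 3.
  by rewrite ler_peMl // exprn_ge0 // ltW.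
have : Q <= delta ^+ 2 * M ^+ 3.
  by rewrite -(ler_pM2l n0R) mulrA; apply: le_trans hQ hM.
rewrite ler_pdivrMr //; lra.
Qed.

End Blowup.

(** * From nice equipartitions of the blow-up to their order *)

Lemma edges_betweenE (R : realType) (G : sgraph) (A B : {set vertex G}) :
  (edges_between A B)%:R = \sum_(a in A) \sum_(b in B) (adj a b)%:R :> R.
Proof.
rewrite /edges_between card_mem natr_sum pair_big /=.
by apply: eq_bigl => -[a b]; rewrite !inE.
Qed.

(** All sets concerned have at least [l] points, so the absolute error [disc] changes a density by
    at most [eps]. *)
Lemma calm_regular (R : realType) (G : sgraph) (p : vertex G -> vertex G -> R)
    (eps disc l : R) (A B : {set vertex G}) :
  0 < l -> l <= eps * #|A|%:R -> l <= eps * #|B|%:R ->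
  disc <= eps * l ^+ 2 ->
  (forall A0 B0 : {set vertex G},
     `|(edges_between A0 B0)%:R - \sum_(a in A0) \sum_(b in B0) p a b| <= disc) ->
  regular_pair eps A B -> calm eps p A B.
Proof.
move=> l0 lA lB discl hdisc /forallP reg A0 A1 B0 A0A A1A B0B A0big A1big B0big.
have lB0 : l <= #|B0|%:R by apply: le_trans B0big.
have B00 : 0 < #|B0|%:R :> R by apply: lt_le_trans lB0.
have disc0 : 0 <= disc by apply: le_trans (hdisc A B).
have e0 : 0 <= eps.
  by rewrite -(pmulr_lge0 _ (exprn_gt0 2 l0)); apply: le_trans discl.
have near (C : {set vertex G}) : C \subset A -> eps * #|A|%:R <= #|C|%:R ->
    `|\sum_(y in B0) avg C (p^~ y) - density R A B * #|B0|%:R| <= 2%:R * eps * #|B0|%:R.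
  move=> CA Cbig; have lC : l <= #|C|%:R by apply: le_trans Cbig.
  have C0 : 0 < #|C|%:R :> R by apply: lt_le_trans lC.
  have := reg C => /forallP/(_ B0); rewrite CA B0B Cbig B0big /= => hreg.
  have hd := hdisc C B0.
  have -> : \sum_(y in B0) avg C (p^~ y) = (\sum_(a in C) \sum_(b in B0) p a b) / #|C|%:R.
    by rewrite /avg -mulr_suml exchange_big.
  set P := \sum_(a in C) _ in hd *.
  have P1 : `|P / #|C|%:R - (edges_between C B0)%:R / #|C|%:R| <= eps * #|B0|%:R.
    rewrite -mulrBl normrM normfV (ger0_norm (ltW C0)) ler_pdivrMr // distrC.
    apply: le_trans hd _; apply: le_trans discl _; rewrite expr2 -mulrA.
    by rewrite ler_wpM2l // ler_pM // ltW.
  have -> : P / #|C|%:R - density R A B * #|B0|%:R =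
      (P / #|C|%:R - (edges_between C B0)%:R / #|C|%:R) -
      (density R A B - density R C B0) * #|B0|%:R.
    rewrite [density R C B0]/density; field.
    by rewrite !gt_eqF.
  apply: le_trans (ler_normB _ _) _; rewrite [X in _ + X]normrM (ger0_norm (ltW B00)).
  have := ler_wpM2r (ltW B00) hreg; lra.
have n0 := near _ A0A A0big; have n1 := near _ A1A A1big.
rewrite sumrB; set X := \sum_(y in B0) _ in n0 *; set Y := \sum_(y in B0) _ in n1 *.
move: n0 n1; rewrite !ler_norml; lra.
Qed.

(** At the last level half of each part lies in one class, which has only [#|palette n t|] points.
    So a part holds at most a proportion [2 / #|V|] of all vertices. *)
Lemma nice_order_large (R : realType) (eps : R) (V : finType) s
    (w : nat -> rel V) (m : nat) :
  0 < eps -> (0 < s)%N -> 2560%:R * s%:R * s%:R * eps < 1 ->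
  tower s w -> (forall x y, agree w s x y -> x = y) -> (0 < #|V|)%N ->
  nice_order_bound eps m -> (#|V| <= 2 * m)%N.
Proof.
case: s => // t e0 _ small tw winj V0 bound.
have se : 32%:R * t.+1%:R * eps <= 1 / 2%:R.
  have : t.+1%:R * eps <= t.+1%:R * t.+1%:R * eps.
    by rewrite ler_pM2r // ler_peMr // ler1n.
  have : 0 <= t.+1%:R * eps by rewrite mulr_ge0 // ltW.
  lra.
(* Chosen so that [delta * M ^ 2 = eps * l ^ 2] for the [l] below; [m.+1] keeps the divisors
   positive. *)
pose delta : R := eps ^+ 3 / (4%:R * m.+1%:R ^+ 2).
have delta0 : 0 < delta by rewrite divr_gt0 ?mulr_gt0 ?exprn_gt0.
(* The first bound serves the discrepancy; the second gives [2 * m.+1 <= M], so that size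
   differences of 1 between parts cost only a factor 2. *)
pose n := maxn (Num.truncn (delta ^- 2)).+1 (2 * m.+1).
have n0 : (0 < n)%N by rewrite leq_max.
have dn : delta ^- 2 <= n%:R.
  have : delta ^- 2 < (Num.truncn (delta ^- 2)).+1%:R.
    have := truncn_itv (_ : 0 <= delta ^- 2).
    by rewrite invr_ge0 exprn_ge0 ?(ltW delta0) // => /(_ isT)/andP[].
  by move=> /ltW h; apply: le_trans h _; rewrite ler_nat leq_maxl.
pose G := SGraph (@blow_adj_sym V w n t) (@blow_adj_irrefl V w n t).
have [P [[partP sizeP] niceP Pm]] := bound G.
set M := #|vertex G|.
have ME : (M = #|V| * #|palette n t|)%N by rewrite /M card_prod.
have nM : (n <= M)%N.
  rewrite ME card_prod card_ord mulnCA leq_pmulr // muln_gt0 V0.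
  by rewrite card_ffun !card_ord expn_gt0.
have mM : (2 * m.+1 <= M)%N by apply: leq_trans nM; rewrite leq_maxr.
have sumM : (\sum_(B in P) #|B| = M)%N by rewrite -(card_partition partP) cardsT.
set k := #|P|.
have k0 : (0 < k)%N.
  rewrite card_gt0; apply/eqP => P0; move: mM.
  by rewrite -sumM P0 big_set0.
have lower A : A \in P -> (M <= 2 * m * #|A|)%N.
  move=> AP; have : (M <= k * (#|A| + 1))%N.
    by rewrite -sumM -sum_nat_const; apply: leq_sum => B BP; apply: sizeP.
  have : (k * (#|A| + 1) <= m * (#|A| + 1))%N by rewrite leq_mul2r Pm orbT.
  move: (#|A|) mM; clearbody M k; clear; lia.
have upper A : A \in P -> (k * #|A| <= 2 * M)%N.
  move=> AP; apply: (@leq_trans (M + k)).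
    apply: (@leq_trans (\sum_(B in P) (#|B| + 1))).
      by rewrite -sum_nat_const; apply: leq_sum => B BP; apply: sizeP.
    by rewrite big_split /= sumM sum1_card.
  move: mM Pm; rewrite -/k; clearbody M k; clear; lia.
pose p : vertex G -> vertex G -> R := weight R t.+1 (pull (palette n t) w).
pose l : R := eps * M%:R / (2%:R * m.+1%:R).
have m0 : 0 < m.+1%:R :> R by [].
have M0 : 0 < M%:R :> R by rewrite ltr0n; apply: leq_trans mM.
have l0 : 0 < l by rewrite !mulr_gt0 ?invr_gt0 ?mulr_gt0.
have lA A : A \in P -> l <= eps * #|A|%:R.
  move=> AP; rewrite /l -mulrA ler_pM2l // ler_pdivrMr ?mulr_gt0 //.
  rewrite -!natrM ler_nat mulnC; apply: leq_trans (lower A AP) _.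
  by rewrite leq_mul2r leq_mul2l leqnSn !orbT.
have discl : delta * M%:R ^+ 2 <= eps * l ^+ 2.
  rewrite le_eqVlt; apply/orP; left; apply/eqP; rewrite /delta /l; field.
  by rewrite gt_eqF.
have calmP A B : A \in P -> B \in P -> regular_pair eps A B -> calm eps p A B.
  move=> AP BP; apply: (calm_regular l0 (lA A AP) (lA B BP) discl) => A0 B0.
  by rewrite edges_betweenE; apply: (blow_discrepancy w V0 n0 A0 B0 delta0 dn).
have conc : forall A, A \in P -> concentrated (pull (palette n t) w) t.+1
    (32%:R * t.+1%:R * eps) A.
  apply: (@concentrated_all R (vertex G) t.+1 _ eps P) => //.
    exact: tower_pull.
  (* At most [eps * k] parts are exceptional, each of at most [2 * M / k] vertices. *)
  move=> A AP; set D := [set B in P | ~~ regular_pair eps A B]%SET.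
  have DP B : B \in D -> B \in P by rewrite inE => /andP[].
  exists D; split; first by move=> B BP; rewrite inE BP /= negbK; apply: calmP.
  have kR : 0 < k%:R :> R by rewrite ltr0n.
  rewrite -(ler_pM2l kR) mulr_sumr.
  apply: (@le_trans _ _ (\sum_(B in D) (2 * M)%:R)).
    rewrite (eq_bigl (fun B => B \in D)) => [|B].
      by apply: ler_sum => B /DP BP; rewrite -natrM ler_nat upper.
    by case: (boolP (B \in D)) => [/DP ->|]; rewrite ?andbF.
  rewrite sumr_const -[X in X <= _]mulr_natl natrM.
  have := ler_wpM2r (ltW M0) (niceP A AP); rewrite -/k -/M -/D; lra.
have each A : A \in P -> (#|V| * #|A| <= 2 * M)%N.
  move=> AP; have [x0 hx0] := conc A AP.
  have : #|[set x in A | agree (pull (palette n t) w) t.+1 x0 x]|%:R <= #|palette n t|%:R :> R.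
    rewrite ler_nat; apply: (@leq_trans #|finset.setX [set x0.1]%SET [set: palette n t]%SET|).
      apply/subset_leq_card/fintype.subsetP => x; rewrite !inE andbT => /andP[_].
      by rewrite agree_pull => /winj ->.
    by rewrite cardsX cards1 mul1n cardsT.
  move=> cls; have : #|A|%:R <= 2%:R * #|palette n t|%:R :> R.
    have : 1 / 2%:R * #|A|%:R <= (1 - 32%:R * t.+1%:R * eps) * #|A|%:R.
      by rewrite ler_wpM2r //; lra.
    lra.
  rewrite -natrM ler_nat => /(leq_mul (leqnn #|V|)).
  by rewrite ME [X in _ -> (_ <= X)%N]mulnCA.
have : (#|V| * M <= k * (2 * M))%N.
  by rewrite -{1}sumM big_distrr /= -sum_nat_const; apply: leq_sum.
rewrite mulnA leq_pmul2r ?(leq_trans _ mM) // mulnC => /leq_trans; apply.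
by rewrite leq_mul2l Pm.
Qed.

(** * Choice of the constant *)

Theorem theorem2 (R : realType) :
  exists2 c : R, 0 < c &
    forall eps : R, 0 < eps -> eps < c ->
      ((twr (c / Num.sqrt eps))%:R%:E <= Mprime eps)%E.
Proof.
(* With [h ^ 2 * eps <= c ^ 2 <= c] and [eps < c], [(h + 4) ^ 2 * eps <= 5 * h ^ 2 * eps + 20 * eps
   < 25 * c], and [2560 * 25 * c < 1]. *)
pose c : R := 100%:R ^- 3.
have c1 : 100%:R * (100%:R * (100%:R * c)) = 1.
  by rewrite /c; field.
have c0 : 0 < c by rewrite invr_gt0 exprn_gt0.
exists c => // eps e0 ec; apply: le_ereal_inf_tmp => _ [m bound <-].
rewrite lee_fin ler_nat /twr; set x := c / Num.sqrt eps; set h := Num.truncn x.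
have se0 : 0 < Num.sqrt eps by rewrite sqrtr_gt0.
have hx : h%:R <= x by have /truncn_itv/andP[] : 0 <= x by rewrite divr_ge0 ?ltW.
have h2 : h%:R * h%:R * eps <= c * c.
  have : h%:R * Num.sqrt eps <= c by rewrite -ler_pdivlMr.
  move=> hc; have := ler_pM _ _ hc hc; rewrite !mulr_ge0 ?(ltW se0) // => /(_ isT isT).
  by rewrite mulrACA -(expr2 (Num.sqrt eps)) sqr_sqrtr // ltW.
have [V [w [tw winj big]]] := tower_exists h.
have V0 : (0 < #|V|)%N.
  by apply: leq_trans big; case: (h) => //= k; rewrite muln_gt0 expn_gt0.
have small : 2560%:R * (h + 4)%:R * (h + 4)%:R * eps < 1.
  have he : (2%:R * (h%:R * eps)) <= (h%:R * h%:R * eps + eps).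
    have := mulr_ge0 (sqr_ge0 (h%:R - 1)) (ltW e0); lra.
  have cc : c * c <= c by rewrite ler_piMl ?(ltW c0) //; lra.
  rewrite natrD; lra.
have := nice_order_large e0 _ small tw winj V0 bound.
rewrite addn4 => /(_ isT)/(leq_trans big).
rewrite -(mulnA 2 8) leq_pmul2l //; apply: leq_trans; exact: leq_pmull.
Qed.
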